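(* Let $|\psi_1\rangle$ be an entangled bipartite pure state with greatest Schmidt coefficient $\alpha_1$, let $k\ge2$ be an integer, and let $|\Phi_k\rangle=\frac{1}{\sqrt{k}}\sum_{i=1}^k|i\rangle|i\rangle$ be a $k\times k$ maximally entangled state. Then the deterministic entanglement exchange rate satisfies $$D(|\psi_1\rangle,|\Phi_k\rangle)=-\log_k\alpha_1.$$
   Context: All states are bipartite pure states on finite-dimensional spaces. Such a state has a Schmidt decomposition $|\psi\rangle=\sum_{i=1}^n\sqrt{\alpha_i}\,|i\rangle|i\rangle$ with $\alpha_1\ge\dots\ge\alpha_n\ge 0$, $\sum_i\alpha_i=1$; the numbers $\alpha_i$ (without square root) are called its Schmidt coefficients, and $\lambda_\psi=(\alpha_1,\dots,\alpha_n)$ is its ordered Schmidt coefficient vector. The state is entangled if at least two Schmidt coefficients are nonzero (equivalently $\alpha_1<1$). For a tensor product of bipartite states, each party holds the corresponding halves of all factors, so the Schmidt coefficients of $|\psi\rangle\otimes|\phi\rangle$ are all products of a Schmidt coefficient of $|\psi\rangle$ with one of $|\phi\rangle$. Write $|\psi_1\rangle\rightarrow|\psi_2\rangle$ if $|\psi_1\rangle$ can be transformed into $|\psi_2\rangle$ with certainty by local operations and classical communication (LOCC). By Nielsen's theorem (known, may be used as the definition), this holds if and only if $\lambda_{\psi_1}\prec\lambda_{\psi_2}$, i.e. for every $l$ the sum of the $l$ largest components of $\lambda_{\psi_1}$ is at most that of $\lambda_{\psi_2}$ (vectors being padded with zeros to a common length). For entangled states $|\psi_1\rangle,|\psi_2\rangle$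 and a positive integer $m$, let $f(m)=\max\{n\geq 1: |\psi_1\rangle^{\otimes m}\rightarrow|\psi_2\rangle^{\otimes n}\}$, with $f(m)=0$ if this set is empty. The deterministic entanglement exchange rate is $D(|\psi_1\rangle,|\psi_2\rangle)=\sup_{m\ge1}\frac{f(m)}{m}$. *)

(* Defs.v *)
From mathcomp Require Import all_boot all_order all_algebra.
From mathcomp Require Import complex mxtens.
From mathcomp Require Import all_classical all_reals all_analysis.

Set Implicit Arguments.
Unset Strict Implicit.
Unset Printing Implicit Defensive.
Import Order.TTheory GRing.Theory Num.Theory.
Local Open Scope ring_scope.
Local Open Scope classical_set_scope.
Local Open Scope complex_scope.

(* A bipartite vector of C^dA (x) C^dB is represented by its amplitude matrix
   psi : 'M[R[i]]_(dA, dB), i.e. |psi> = \sum_(i, j) psi i j |i>|j>. When each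
   party holds its halves of both factors, the amplitude matrix of a tensor
   product is the Kronecker product [tensmx], so that the amplitude matrix of
   the m-th tensor power is [ntensmx psi m] : 'M_(dA ^ m, dB ^ m). *)

Definition pure_state (R : realType) (dA dB : nat) (psi : 'M[R[i]]_(dA, dB)) :=
  \sum_i \sum_j `|psi i j| ^+ 2 = 1.

(* [unitarymx] applies to rectangular matrices and means that the rows are
   orthonormal: the rows of U and V are the two local orthonormal families.
   Zero coefficients may be listed or omitted, so [a] is determined by [psi]
   only up to trailing zeros; no notion below depends on them. *)
Definition schmidt_coefficients (R : realType) (dA dB : nat)
    (psi : 'M[R[i]]_(dA, dB)) (a : seq R) : Prop :=
  [/\ sorted >=%R a, all (>= 0) a, \sum_(x <- a) x = 1 &
      exists (U : 'M[R[i]]_(size a, dA)) (V : 'M[R[i]]_(size a, dB)),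
        [/\ U \is unitarymx, V \is unitarymx &
            psi = \sum_(i < size a)
                    (Num.sqrt a`_i)%:C *: ((row i U)^T *m row i V)]].

Definition entangled (R : realType) (dA dB : nat) (psi : 'M[R[i]]_(dA, dB)) :=
  exists2 a, schmidt_coefficients psi a & (2 <= count (fun x : R => x != 0%R) a)%N.

(* Meant for vectors in nonincreasing order; a`_i is 0 for i >= size a, which
   is the padding with zeros. *)
Definition majorized (R : realType) (a b : seq R) : Prop :=
  forall l : nat, \sum_(i < l) a`_i <= \sum_(i < l) b`_i.

(* Deterministic LOCC convertibility, through Nielsen's theorem. *)
Definition locc (R : realType) (dA dB dA' dB' : nat)
    (psi : 'M[R[i]]_(dA, dB)) (phi : 'M[R[i]]_(dA', dB')) : Prop :=
  exists a b, [/\ schmidt_coefficients psi a, schmidt_coefficients phi b &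
                  majorized a b].

Section ExchangeRate.
Variables (R : realType) (dA dB dA' dB' : nat).
Variables (psi : 'M[R[i]]_(dA, dB)) (phi : 'M[R[i]]_(dA', dB')).

Definition reachable (m : nat) : set nat :=
  [set n | (1 <= n)%N /\ locc (ntensmx psi m) (ntensmx phi n)].

(* The maximum of [reachable m], and 0 when that set is empty. *)
Definition max_copies (m : nat) : nat :=
  xget 0%N [set n | reachable m n /\ ubound (reachable m) n].

Definition exchange_rate : \bar R :=
  ereal_sup [set ((max_copies m)%:R / m%:R)%:E | m in [set m | (1 <= m)%N]].

End ExchangeRate.

(* |Phi_k> = k^(-1/2) \sum_(i < k) |i>|i> *)
Definition max_entangled (R : realType) (k : nat) : 'M[R[i]]_k :=
  ((Num.sqrt k%:R)^-1)%:C%:M.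

(* Main.v *)
(** The target [Phi_k^n] has [k^n] equal Schmidt coefficients [k^-n], so a state
    is majorized by it as soon as its greatest Schmidt coefficient is at most
    [k^-n], the remaining partial sums being bounded by [l k^-n] and by [1].  As
    the greatest coefficient of [psi^m] is [alpha_1^m], the reachable [n >= 1]
    are those with [alpha_1^m <= k^-n], that is [n <= - m log_k alpha_1]; hence
    [f(m)] is the integer part of [- m log_k alpha_1], and [f(m) / m] is at most
    [- log_k alpha_1] and tends to it. *)

Require Import Defs.
From mathcomp Require Import all_boot all_order all_algebra.
From mathcomp Require Import perm complex mxtens.
From mathcomp Require Import all_classical all_reals all_analysis.
Import Order.TTheory GRing.Theory Num.Theory.
Local Open Scope ring_scope.
Local Open Scope complex_scope.

Set Implicit Arguments.
Unset Strict Implicit.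
Unset Printing Implicit Defensive.

(** * Schmidt decompositions up to reordering *)

Section SchmidtFamily.
Variable R : realType.
Implicit Types (dA dB n : nat).

Definition sqrt_diag n (c : 'I_n -> R) : 'M[R[i]]_n :=
  diag_mx (\row_i (Num.sqrt (c i))%:C).

(* Schmidt decompositions without the ordering of the coefficients, which the
   tensor product does not preserve. *)
Definition schmidt_family dA dB (psi : 'M[R[i]]_(dA, dB)) n (c : 'I_n -> R) :=
  [/\ forall i, 0 <= c i, \sum_i c i = 1 &
      exists (U : 'M[R[i]]_(n, dA)) (V : 'M[R[i]]_(n, dB)),
        [/\ U \is unitarymx, V \is unitarymx & psi = U^T *m sqrt_diag c *m V]].

(** Links the sum of rank-one terms to the factored form, in which tensor and adjoint computations
    are plain matrix algebra. *)
Lemma mulmx_tr_diag n dA dB (d : 'rV[R[i]]_n) (U : 'M[R[i]]_(n, dA))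
    (V : 'M[R[i]]_(n, dB)) :
  U^T *m diag_mx d *m V = \sum_i d 0 i *: ((row i U)^T *m row i V).
Proof.
apply/matrixP => i j; rewrite mul_mx_diag mxE summxE; apply: eq_bigr => l _.
by rewrite !mxE big_ord1 !mxE mulrAC mulrC.
Qed.

Lemma schmidt_coefficientsP dA dB (psi : 'M[R[i]]_(dA, dB)) (a : seq R) :
  schmidt_coefficients psi a <->
  sorted >=%R a /\ schmidt_family psi (fun i : 'I_(size a) => a`_i).
Proof.
split=> [[sa a_ge0 a_sum [U [V [uU uV psiE]]]]|
         [sa [a_ge0 a_sum [U [V [uU uV psiE]]]]]].
  split=> //; split.
  - by move=> i; apply: (allP a_ge0); rewrite mem_nth.
  - by rewrite -a_sum (big_nth 0) big_mkord.
  - exists U, V; split=> //; rewrite psiE mulmx_tr_diag.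
    by apply: eq_bigr => i _; rewrite mxE.
split=> //.
- by apply/(all_nthP 0) => i lt_ia; exact: (a_ge0 (Ordinal lt_ia)).
- by rewrite (big_nth 0) big_mkord.
- exists U, V; split=> //; rewrite psiE mulmx_tr_diag.
  by apply: eq_bigr => i _; rewrite mxE.
Qed.

Lemma row_row_perm (T : Type) m n (s : 'S_m) (A : 'M[T]_(m, n)) i :
  row i (row_perm s A) = row (s i) A.
Proof. by apply/rowP => j; rewrite !mxE. Qed.

Lemma schmidt_coefficients_family dA dB (psi : 'M[R[i]]_(dA, dB)) n
    (c : 'I_n -> R) (a : seq R) :
  size a = n -> sorted >=%R a -> (forall i : 'I_n, a`_i = c i) ->
  schmidt_family psi c -> schmidt_coefficients psi a.
Proof.
move=> szE; case: n / szE c => c sa aE cP; apply/schmidt_coefficientsP.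
by split=> //; rewrite (_ : (fun i => _) = c) //; apply/funext.
Qed.

Lemma schmidt_family_perm dA dB (psi : 'M[R[i]]_(dA, dB)) n (c : 'I_n -> R)
    (s : 'S_n) :
  schmidt_family psi c -> schmidt_family psi (c \o s).
Proof.
case=> c_ge0 c_sum [U [V [uU uV ->]]]; split=> [i /=|/=|] //.
  by rewrite -c_sum [RHS](reindex_inj (@perm_inj _ s)).
exists (row_perm s U), (row_perm s V); split.
- apply/row_unitarymxP => i j; rewrite !row_row_perm (row_unitarymxP uU).
  by rewrite (inj_eq perm_inj).
- apply/row_unitarymxP => i j; rewrite !row_row_perm (row_unitarymxP uV).
  by rewrite (inj_eq perm_inj).
- rewrite !mulmx_tr_diag (reindex_inj (@perm_inj _ s)) /=.
  by apply: eq_bigr => i _; rewrite !row_row_perm !mxE.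
Qed.

(** The permutation that sorts the coefficients is applied to both local families as well. *)
Lemma schmidt_family_sort dA dB (psi : 'M[R[i]]_(dA, dB)) n (c : 'I_n -> R) :
  schmidt_family psi c ->
  exists2 a, schmidt_coefficients psi a & perm_eq a (codom c).
Proof.
move=> cP; pose a := sort >=%R (codom c).
have aP : perm_eq a (codom c) by rewrite perm_sort.
have /tuple_permP[s aE] : perm_eq a [tuple c i | i < n] := aP.
exists a => //.
apply: (schmidt_coefficients_family _ _ _ (schmidt_family_perm s cP)).
- by rewrite (perm_size aP) size_map -cardE card_ord.
- by apply: sort_sorted => x y; exact: le_total.
- by move=> i; rewrite aE -tnth_nth !tnth_mktuple.
Qed.

(** * Tensor products of unordered decompositions *)

Lemma tens_unitarymx m n p q (U : 'M[R[i]]_(m, n)) (V : 'M[R[i]]_(p, q)) :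
  U \is unitarymx -> V \is unitarymx -> U *t V \is unitarymx.
Proof.
move=> /unitarymxP uU /unitarymxP uV; apply/unitarymxP.
rewrite trmx_tens map_mxT tensmx_mul uU uV.
apply/matrixP => i j; rewrite !mxE -natrM mulnb; congr (_%:R).
(* A product of two Kronecker deltas is the delta of the pair, and [mxtens_unindex] is injective. *)
by rewrite -(can_eq (@mxtens_unindexK m p)) xpair_eqE.
Qed.

Lemma schmidt_family_tens dA dB dA' dB' (psi : 'M[R[i]]_(dA, dB))
    (phi : 'M[R[i]]_(dA', dB')) n (c : 'I_n -> R) n' (c' : 'I_n' -> R) :
  schmidt_family psi c -> schmidt_family phi c' ->
  schmidt_family (psi *t phi)
    (fun i => c (mxtens_unindex i).1 * c' (mxtens_unindex i).2).
Proof.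
move=> [c_ge0 c_sum [U [V [uU uV ->]]]] [c'_ge0 c'_sum [U' [V' [uU' uV' ->]]]].
split=> [i||]; first by rewrite mulr_ge0.
  by rewrite -mulr_sum c_sum c'_sum mulr1.
exists (U *t U'), (V *t V'); split; [exact: tens_unitarymx..|].
rewrite -!tensmx_mul trmx_tens; congr (_ *m _ *m _).
apply/matrixP => i j; rewrite !mxE mulrnAr mulrnAl -mulrnA mulnb sqrtrM //.
rewrite -rmorphM /=; congr (_ *+ _).
by rewrite -(can_eq (@mxtens_unindexK n n')) xpair_eqE.
Qed.

(** * Uniqueness of the nonzero Schmidt coefficients *)

(** Orthonormality of the rows of [V] cancels them in [psi psi^*], and the square roots pair up into
    [c i]. *)
Lemma gram_schmidt n dA dB (c : 'I_n -> R) (U : 'M[R[i]]_(n, dA))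
    (V : 'M[R[i]]_(n, dB)) (psi := U^T *m sqrt_diag c *m V) :
  (forall i, 0 <= c i) -> V \is unitarymx ->
  psi *m map_mx Num.conj psi^T =
  U^T *m diag_mx (\row_i (c i)%:C) *m map_mx Num.conj U.
Proof.
move=> c_ge0 /unitarymxP uV.
rewrite /psi !trmx_mul !map_mxM trmxK !mulmxA; congr (_ *m _).
rewrite -!mulmxA [V *m _]mulmxA uV mul1mx; congr (_ *m _).
rewrite tr_diag_mx map_diag_mx mulmx_diag; congr diag_mx.
apply/rowP => i; rewrite !mxE.
rewrite [X in _ * X]conjc_real -rmorphM -expr2 /= sqr_sqrtr //.
Qed.

(* The nonzero Schmidt coefficients are the nonzero eigenvalues of
   [psi psi^*], hence do not depend on the decomposition. *)
Lemma schmidt_family_coef dA dB (psi : 'M[R[i]]_(dA, dB))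
    n (c : 'I_n -> R) n' (c' : 'I_n' -> R) (i : 'I_n) :
  schmidt_family psi c -> schmidt_family psi c' -> c i != 0 ->
  exists j, c' j = c i.
Proof.
have conjU m d (U : 'M[R[i]]_(m, d)) :
    U \is unitarymx -> map_mx Num.conj U *m U^T = 1%:M.
  move=> /unitarymxP/(congr1 (map_mx Num.conj)).
  rewrite map_mxM map_mx1 -map_mx_comp => <-; congr (_ *m _).
  by apply/matrixP => p q; rewrite !mxE [RHS]conjCK.
move=> [c_ge0 _ [U [V [uU uV psiE]]]] [c'_ge0 _ [U' [V' [uU' uV' psiE']]]] ci0.
have G : U^T *m diag_mx (\row_i (c i)%:C) *m map_mx Num.conj U =
         U'^T *m diag_mx (\row_i (c' i)%:C) *m map_mx Num.conj U'.
  by rewrite -(gram_schmidt _ c_ge0 uV) -(gram_schmidt _ c'_ge0 uV')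
             -psiE -psiE'.
(* [v] is a left eigenvector of [psi psi^*] for the eigenvalue [c i]; [w] lists its inner products
   with the rows of [U']. *)
pose v := row i (map_mx Num.conj U); pose w := v *m U'^T.
have vG : (c i)%:C *: v = w *m diag_mx (\row_i (c' i)%:C) *m map_mx Num.conj U'.
  rewrite /w -!mulmxA (mulmxA U'^T) -G -row_mul !mulmxA conjU // mul1mx.
  by apply/rowP => j; rewrite mul_diag_mx !mxE.
have wE : (c i)%:C *: w = w *m diag_mx (\row_i (c' i)%:C).
  by rewrite {1}/w scalemxAl vG -[LHS]mulmxA conjU // mulmx1.
case: (pselect (exists j, c' j = c i)) => // nex.
(* By [wE], a nonzero entry of [w] at [j] would force [c' j = c i]. *)
have w0 : w = 0.
  apply/rowP => j; move/rowP/(_ j): wE; rewrite mul_mx_diag !mxE.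
  move/eqP; rewrite mulrC -subr_eq0 -mulrBr mulf_eq0 => /orP[/eqP //|].
  rewrite -rmorphB fmorph_eq0 subr_eq0 => /eqP cj.
  by case: nex; exists j.
(* As [c i] is nonzero, [v] vanishes, although entry [i] of [v U^T] is 1. *)
have /eqP : (c i)%:C *: v = 0 by rewrite vG w0 !mul0mx.
rewrite scaler_eq0 fmorph_eq0 (negPf ci0) /= => /eqP v0.
have : v *m U^T = row i 1%:M by rewrite -row_mul conjU.
rewrite v0 mul0mx => /rowP/(_ i)/eqP; rewrite !mxE eqxx.
by rewrite eq_sym oner_eq0.
Qed.

(** * The greatest Schmidt coefficient *)

Lemma schmidt_coefficients_ge0 dA dB (psi : 'M[R[i]]_(dA, dB)) a i :
  schmidt_coefficients psi a -> 0 <= a`_i.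
Proof.
case=> _ a_ge0 _ _; have [lt_ia|le_ai] := ltnP i (size a).
  by apply: (allP a_ge0); rewrite mem_nth.
by rewrite nth_default.
Qed.

Lemma schmidt_coefficients_anti dA dB (psi : 'M[R[i]]_(dA, dB)) a i j :
  schmidt_coefficients psi a -> (i <= j)%N -> a`_j <= a`_i.
Proof.
move=> aP le_ij; have [lt_ja|le_aj] := ltnP j (size a); last first.
  by rewrite (nth_default _ le_aj) (schmidt_coefficients_ge0 _ aP).
case: aP => a_sorted _ _ _.
apply: (sorted_leq_nth _ _ _ a_sorted) => //.
- by move=> y x z /= xy yz; exact: le_trans yz xy.
- by move=> x /=.
- by rewrite inE (leq_ltn_trans le_ij).
Qed.

Lemma schmidt_coefficients_head_gt0 dA dB (psi : 'M[R[i]]_(dA, dB)) a :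
  schmidt_coefficients psi a -> 0 < a`_0.
Proof.
move=> aP; rewrite lt_neqAle (schmidt_coefficients_ge0 _ aP) andbT eq_sym.
apply/negP => /eqP a0; have [_ _ a_sum _] := aP.
have /eqP := a_sum; rewrite (big_nth 0) big1 => [|i _].
  by rewrite eq_sym oner_eq0.
apply/eqP; rewrite eq_le (schmidt_coefficients_ge0 _ aP) andbT -[leRHS]a0.
exact: schmidt_coefficients_anti aP _.
Qed.

(** Being nonzero, each head occurs in the other decomposition, hence is bounded by the other
    head. *)
Lemma schmidt_coefficients_head_uniq dA dB (psi : 'M[R[i]]_(dA, dB)) a b :
  schmidt_coefficients psi a -> schmidt_coefficients psi b -> a`_0 = b`_0.
Proof.
suff le_head a' b' : schmidt_coefficients psi a' ->
    schmidt_coefficients psi b' -> a'`_0 <= b'`_0.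
  by move=> aP bP; apply/eqP; rewrite eq_le !le_head.
move=> aP bP; have a0 := schmidt_coefficients_head_gt0 aP.
have a_gt0 : (0 < size a')%N by case: (a') a0 => //=; rewrite ltxx.
have [_ aF] := (schmidt_coefficientsP _ _).1 aP.
have [_ bF] := (schmidt_coefficientsP _ _).1 bP.
have [|j <-] := schmidt_family_coef (i := Ordinal a_gt0) aF bF.
  by rewrite /= gt_eqF.
exact: schmidt_coefficients_anti bP _.
Qed.

(** * Greatest coefficient of tensor products and powers *)

Lemma schmidt_coefficients_tens dA dB dA' dB' (psi : 'M[R[i]]_(dA, dB))
    (phi : 'M[R[i]]_(dA', dB')) a b :
  schmidt_coefficients psi a -> schmidt_coefficients phi b ->
  exists2 d, schmidt_coefficients (psi *t phi) d & d`_0 = a`_0 * b`_0.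
Proof.
move=> aP bP.
have a0 := schmidt_coefficients_head_gt0 aP.
have b0 := schmidt_coefficients_head_gt0 bP.
have a_gt0 : (0 < size a)%N by case: (a) a0 => //=; rewrite ltxx.
have b_gt0 : (0 < size b)%N by case: (b) b0 => //=; rewrite ltxx.
have [_ aF] := (schmidt_coefficientsP _ _).1 aP.
have [_ bF] := (schmidt_coefficientsP _ _).1 bP.
have [d dP dE] := schmidt_family_sort (schmidt_family_tens aF bF).
exists d => //; apply/eqP; rewrite eq_le; apply/andP; split.
  have : d`_0 \in d.
    have := schmidt_coefficients_head_gt0 dP; case: (d) => [/=|x s _].
      by rewrite ltxx.
    exact: mem_head.
  rewrite (perm_mem dE) => /codomP[i ->].
  rewrite ler_pM ?(schmidt_coefficients_ge0 _ aP)
          ?(schmidt_coefficients_ge0 _ bP) //.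
    exact: schmidt_coefficients_anti aP _.
  exact: schmidt_coefficients_anti bP _.
(* Conversely, the product of the heads is itself an entry of [d], so it is at most the head of
   [d]. *)
have : a`_0 * b`_0 \in d.
  rewrite (perm_mem dE); apply/codomP.
  exists (mxtens_index (Ordinal a_gt0, Ordinal b_gt0)).
  by rewrite mxtens_indexK.
case/(nthP 0) => i _ <-; exact: schmidt_coefficients_anti dP _.
Qed.

Lemma schmidt_coefficients_ntens dA dB (psi : 'M[R[i]]_(dA, dB)) a m :
  schmidt_coefficients psi a ->
  exists2 d, schmidt_coefficients (ntensmx psi m.+1) d & d`_0 = a`_0 ^+ m.+1.
Proof.
move=> aP; elim: m => [|m [b bP b0]]; first by exists a.
have [d dP d0] := schmidt_coefficients_tens aP bP.
exists d; last by rewrite d0 b0 -exprS.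
exact: dP.
Qed.

(** * Maximally entangled states *)

(** Kronecker products of scalar matrices are scalar; the target is thus always a single maximally
    entangled state. *)
Lemma ntensmx_max_entangled k n :
  ntensmx (max_entangled R k) n.+1 = max_entangled R (k ^ n.+1).
Proof.
elim: n => [|n IHn]; first by [].
rewrite ntensmxS IHn; apply/matrixP => i j; rewrite !mxE.
rewrite mulrnAr mulrnAl -mulrnA mulnb -rmorphM /= -invfM -sqrtrM //.
congr (((Num.sqrt _)^-1)%:C *+ _); first by rewrite -natrM.
by rewrite -(can_eq (@mxtens_unindexK k (k ^ n.+1))) xpair_eqE.
Qed.

Lemma schmidt_max_entangled k : (0 < k)%N ->
  schmidt_coefficients (max_entangled R k) (nseq k k%:R^-1).
Proof.
move=> k_gt0.
apply: (@schmidt_coefficients_family _ _ _ k (fun=> k%:R^-1)).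
- exact: size_nseq.
(* The entry is generalized first, so that the induction varies the length alone. *)
- by move: (k%:R^-1); case: (k) => // n x; elim: n => //= n ->; rewrite lexx.
- by move=> i; rewrite nth_nseq ltn_ord.
- split=> //.
    by rewrite sumr_const card_ord -[LHS]mulr_natl divff // pnatr_eq0 -lt0n.
  exists 1%:M, 1%:M;
    split; [by apply/unitarymxP; rewrite trmx1 map_mx1 mul1mx..|].
  rewrite trmx1 mul1mx mulmx1; apply/matrixP => i j.
  by rewrite !mxE sqrtrV.
Qed.

(** * Majorization by a uniform vector and reachability *)

Lemma sum_nth_over (a : seq R) l : (size a <= l)%N ->
  \sum_(i < l) a`_i = \sum_(x <- a) x.
Proof.
move=> le_al; rewrite (big_nth 0) -(big_mkord xpredT).
rewrite (big_cat_nat (leq0n _) le_al) //=.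
rewrite [X in _ + X]big_nat_cond [X in _ + X]big1 ?addr0 // => i.
by rewrite andbT => /andP[le_ai _]; rewrite nth_default.
Qed.

Lemma sum_nth_le (a : seq R) l : (forall i, 0 <= a`_i) ->
  \sum_(i < l) a`_i <= \sum_(x <- a) x.
Proof.
move=> a_ge0; rewrite -(sum_nth_over (leq_maxl (size a) l)).
rewrite -!(big_mkord xpredT (fun i => a`_i)).
rewrite (big_cat_nat (leq0n l) (leq_maxr (size a) l)) /= lerDl.
by apply: sumr_ge0.
Qed.

Lemma majorized_uniform dA dB (psi : 'M[R[i]]_(dA, dB)) a k : (0 < k)%N ->
  schmidt_coefficients psi a -> a`_0 <= k%:R^-1 ->
  majorized a (nseq k k%:R^-1).
Proof.
move=> k_gt0 aP a0 l; have [le_lk|lt_kl] := leqP l k.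
  apply: ler_sum => i _; rewrite nth_nseq (leq_trans (ltn_ord i) le_lk).
  exact: le_trans (schmidt_coefficients_anti aP (leq0n _)) a0.
(* Beyond length [k] the uniform vector has already reached its full sum 1. *)
rewrite [leRHS]sum_nth_over ?size_nseq ?(ltnW lt_kl) //.
have [_ _ -> _] := schmidt_max_entangled k_gt0.
case: (aP) => _ _ <- _; apply: sum_nth_le => i.
exact: schmidt_coefficients_ge0 aP.
Qed.

Lemma reachable_max_entangled dA dB (psi : 'M[R[i]]_(dA, dB)) a k m n :
  schmidt_coefficients psi a -> (0 < k)%N -> (0 < m)%N -> (0 < n)%N ->
  reachable psi (max_entangled R k) m n <-> a`_0 ^+ m <= (k ^ n)%:R^-1.
Proof.
case: m n => // m [] // n aP k_gt0 _ _.
have kn_gt0 : (0 < k ^ n.+1)%N by rewrite expn_gt0 k_gt0.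
have [d dP d0] := schmidt_coefficients_ntens m aP.
rewrite /reachable /= ntensmx_max_entangled -d0; split.
  (* Only the partial sum of length 1 is used; [locc] supplies unknown decompositions, whose heads
     are the expected ones by uniqueness. *)
  case=> _ [b [b' [bP b'P /(_ 1%N)]]]; rewrite !big_ord1.
  rewrite (schmidt_coefficients_head_uniq dP bP).
  rewrite -(schmidt_coefficients_head_uniq (schmidt_max_entangled kn_gt0) b'P).
  by rewrite nth_nseq kn_gt0.
move=> le_d; split=> //; exists d, (nseq (k ^ n.+1) (k ^ n.+1)%:R^-1).
by split=> //; [exact: schmidt_max_entangled|exact: majorized_uniform dP le_d].
Qed.

(** By the ordering, two nonzero coefficients make the second one positive, and the first two add up
    to at most 1. *)
Lemma entangled_head_lt1 dA dB (psi : 'M[R[i]]_(dA, dB)) a :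
  entangled psi -> schmidt_coefficients psi a -> a`_0 < 1.
Proof.
case=> b bP b_cnt aP; rewrite (schmidt_coefficients_head_uniq aP bP).
have b1 : 0 < b`_1.
  rewrite lt_neqAle (schmidt_coefficients_ge0 _ bP) andbT eq_sym.
  apply/negP => /eqP b1.
  suff : (count (fun x : R => x != 0%R) b <= 1)%N by rewrite leqNgt b_cnt.
  case: b b1 bP {b_cnt} => //= x s s0 sP.
  rewrite -[leqRHS]addn0 leq_add ?leq_b1 //.
  rewrite leqNgt -has_count -all_predC; apply/(all_nthP 0) => i _ /=.
  rewrite negbK eq_le (schmidt_coefficients_ge0 i.+1 sP) andbT -[leRHS]s0.
  exact: (schmidt_coefficients_anti sP (_ : (1 <= i.+1)%N)).
have [_ _ <- _] := bP.
apply: lt_le_trans (sum_nth_le 2 _) => [|i].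
  by rewrite big_ord_recr big_ord1 /= ltrDl.
exact: schmidt_coefficients_ge0 bP.
Qed.

(** * The number of copies and the rate *)

Lemma max_copies_max_entangled dA dB (psi : 'M[R[i]]_(dA, dB)) a k m
    (c := - (ln a`_0 / ln k%:R)) :
  schmidt_coefficients psi a -> a`_0 < 1 -> (1 < k)%N -> (0 < m)%N ->
  max_copies psi (max_entangled R k) m = Num.truncn (m%:R * c).
Proof.
move=> aP a_lt1 k_gt1 m_gt0; have a_gt0 := schmidt_coefficients_head_gt0 aP.
have lnk : 0 < ln (k%:R : R) by rewrite ln_gt0 // ltr1n.
have mc_ge0 : 0 <= m%:R * c.
  rewrite mulr_ge0 // /c -mulNr divr_ge0 ?(ltW lnk) //.
  by rewrite oppr_ge0 ln_le0 // ltW.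
have k_gt0 : (0 < k)%N := ltnW k_gt1.
have reachE n : reachable psi (max_entangled R k) m n <->
    (0 < n <= Num.truncn (m%:R * c))%N.
  case: n => [|n]; first by split=> // -[].
  rewrite (reachable_max_entangled aP) // truncn_ge_nat //=.
  (* Logarithms make the condition linear in the exponents; [ln k] is positive and can be divided
     out. *)
  rewrite -ler_ln ?posrE ?exprn_gt0 ?invr_gt0 ?ltr0n ?expn_gt0 ?k_gt0 //.
  rewrite lnV ?posrE ?ltr0n ?expn_gt0 ?k_gt0 // natrX !lnXn ?ltr0n //.
  rewrite /c mulrN mulrA -mulNr ler_pdivlMr //.
  by rewrite !mulr_natl lerNr.
rewrite /max_copies; case: (posnP (Num.truncn (m%:R * c))) => [N0|N_gt0].
  (* Nothing is reachable here, and [xget] returns its default value 0. *)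
  rewrite N0; apply: xgetPN => n [/reachE]; rewrite N0.
  by case: n.
apply: xget_unique.
  split; first by apply/reachE; rewrite N_gt0 leqnn.
  by move=> n /reachE /andP[].
move=> n [/reachE/andP[_ n_le]] /(_ (Num.truncn (m%:R * c))) le_n.
apply/eqP; rewrite eqn_leq n_le /=; apply: le_n.
by apply/reachE; rewrite N_gt0 leqnn.
Qed.

End SchmidtFamily.

Theorem theorem2 (R : realType) (dA dB : nat) (psi1 : 'M[R[i]]_(dA, dB))
    (psi1_state : pure_state psi1) (psi1_entangled : entangled psi1)
    (a : seq R) (psi1_schmidt : schmidt_coefficients psi1 a)
    (k : nat) (k_ge2 : (2 <= k)%N) :
  exchange_rate psi1 (max_entangled R k) = (- (ln a`_0 / ln k%:R))%:E.
Proof.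
have a_lt1 := entangled_head_lt1 psi1_entangled psi1_schmidt.
have a_gt0 := schmidt_coefficients_head_gt0 psi1_schmidt.
have copiesE m := max_copies_max_entangled (m := m) psi1_schmidt a_lt1 k_ge2.
set c := - (ln a`_0 / ln k%:R) in copiesE *.
have c_ge0 : 0 <= c.
  rewrite /c -mulNr divr_ge0 ?oppr_ge0 ?ln_le0 ?(ltW a_lt1) //.
  by rewrite ln_ge0 // ler1n ltnW.
rewrite /exchange_rate; apply/eqP; rewrite eq_le; apply/andP; split.
  apply: ub_ereal_sup => _ [m m_gt0 <-]; rewrite copiesE // lee_fin.
  by rewrite ler_pdivrMr ?ltr0n // mulrC truncn_le mulr_ge0.
apply/lee_addgt0Pr => e e_gt0.
(* This [m] exceeds [1 / e], so truncating [m c] costs at most [1 / m <= e] in the ratio. *)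
pose m := (Num.truncn e^-1).+1.
pose f := max_copies psi1 (max_entangled R k).
apply: (@le_trans _ _ (((f m)%:R / m%:R)%:E + e%:E)%E); last first.
  by apply: leeD2r; apply: ereal_sup_ubound; exists m.
have m_gt0 : 0 < m%:R :> R by rewrite ltr0n.
rewrite /f copiesE // -EFinD lee_fin -lerBlDr ler_pdivlMr //.
have mc_ge0 : 0 <= m%:R * c by rewrite mulr_ge0.
have /andP[_ /ltW c_le] := truncn_itv mc_ge0.
have me : 1 <= e * m%:R.
  rewrite mulrC -ler_pdivrMr // mul1r ltW //.
  have einv_ge0 : 0 <= e^-1 by rewrite invr_ge0 ltW.
  by have /andP[] := truncn_itv einv_ge0.
(* The 1 lost in truncation is absorbed by [e * m]. *)
rewrite mulrBl lerBlDr [c * _]mulrC (le_trans c_le) // -natr1.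
by rewrite lerD2l.
Qed.
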